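(* Fix a constant $r$. Let $G$ be a connected undirected edge-weighted $K_r$-minor-free graph with diameter $\Delta$, and suppose that there is a function $f$ such that for every $\varepsilon\in(0,1)$, $G$ admits an $(\varepsilon,f(\varepsilon))$-shortcut partition. Then for every $\varepsilon\in(0,1)$, $G$ admits an $O(\Delta)$-bounded tree cover of size $2^{O(f(\varepsilon))}$ with additive distortion $+O(\varepsilon\Delta)$ (hidden constants depending only on $r$).
   Context: A cluster is a vertex set $C\subseteq V(G)$ with $G[C]$ connected; a clustering is a partition of $V(G)$ into clusters. The cluster graph $\check G$ is obtained by contracting each cluster into a single node and is treated as unweighted (hop-length = number of edges). A cluster $C$ has strong diameter at most $D$ if $\delta_{G[C]}(u,v)\le D$ for all $u,v\in C$. An $(\varepsilon,h)$-shortcut partition of $G$ (with diameter $\Delta$) is a clustering $\mathcal{C}$ such that (i) every cluster has strong diameter at most $\varepsilon\Delta$, and (ii) for every $u,v\in V(G)$ there is a path $\pi$ in $G$ between $u$ and $v$ of length at most $(1+\varepsilon)\delta_G(u,v)$ and a path $\check\pi$ in $\check G$ between the clusters containing $u$ and $v$ with hop-length at most $h$ and using only clusters that contain a vertex of $\pi$. A dominating tree of $G$ is an edge-weighted tree $T$ with $V(G)\subseteq V(T)$ and $d_T(x,y)\ge\delta_G(x,y)$ for all $x,y\in V(G)$. A tree cover with additive distortion $+\beta$ is a collection of dominating trees such that every pair $x,y$ has a tree $T$ with $d_T(x,y)\le\delta_G(x,y)+\beta$; it is $D$-bounded if every tree has diameter at most $D$. *)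

(* Defs.v *)
From Stdlib Require List.
From HB Require Import structures.
From mathcomp Require Import all_boot all_order all_algebra.
From mathcomp Require Import reals.
Set Implicit Arguments. Unset Strict Implicit. Unset Printing Implicit Defensive.
Import Order.TTheory GRing.Theory Num.Theory.
Local Open Scope ring_scope.

Section Graphs.
Variable R : realType.

Definition wgraph (V : finType) (e : rel V) (w : V -> V -> R) : Prop :=
  [/\ forall x y, e x y = e y x, forall x, ~~ e x x,
      forall x y, w x y = w y x & forall x y, e x y -> 0 < w x y].

Definition connected_graph (V : finType) (e : rel V) : Prop :=
  forall x y, connect e x y.

Fixpoint plen (V : Type) (w : V -> V -> R) (x : V) (p : seq V) : R :=
  if p is y :: q then w x y + plen w y q else 0.

Definition gdist (V : finType) (e : rel V) (w : V -> V -> R) (x y : V) : R :=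
  inf (fun z : R => exists p : seq V, [/\ path e x p, last x p = y & plen w x p = z]).

Definition gdiam (V : finType) (e : rel V) (w : V -> V -> R) : R :=
  \big[Num.max/0]_(x : V) \big[Num.max/0]_(y : V) gdist e w x y.

Definition induced (V : finType) (e : rel V) (C : {set V}) : rel V :=
  [rel x y | [&& e x y, x \in C & y \in C]].

Definition has_K_minor (V : finType) (e : rel V) (r : nat) : Prop :=
  exists B : 'I_r -> {set V},
    [/\ forall i, B i != set0,
        forall i j, i != j -> [disjoint B i & B j],
        forall i u v, u \in B i -> v \in B i -> connect (induced e (B i)) u v
      & forall i j, i != j -> exists u v, [/\ u \in B i, v \in B j & e u v]].

Definition cadj (V : finType) (e : rel V) (P : {set {set V}}) : rel {set V} :=
  [rel C D | [&& C \in P, D \in P, C != D &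
               [exists x, exists y, [&& x \in C, y \in D & e x y]]]].

Definition shortcut_partition (V : finType) (e : rel V) (w : V -> V -> R)
    (eps : R) (h : nat) (P : {set {set V}}) : Prop :=
  [/\ partition P [set: V],
      forall C, C \in P -> forall u v, u \in C -> v \in C ->
        connect (induced e C) u v,
      forall C, C \in P -> forall u v, u \in C -> v \in C ->
        gdist (induced e C) w u v <= eps * gdiam e w
    &
      forall u v, exists pi : seq V,
        [/\ path e u pi, last u pi = v,
            plen w u pi <= (1 + eps) * gdist e w u v &
            exists q : seq {set V},
              [/\ path (cadj e P) (pblock P u) q,
                  last (pblock P u) q = pblock P v,
                  (size q <= h)%N &
                  all (fun C : {set V} => has (fun x => x \in C) (u :: pi))
                      (pblock P u :: q)]]].

Record dtree (V : finType) := DTree {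
  tU : finType; tE : rel tU; tW : tU -> tU -> R; tEmb : V -> tU }.

Definition is_tree (U : finType) (e : rel U) (w : U -> U -> R) : Prop :=
  [/\ forall x y, e x y = e y x, forall x, ~~ e x x,
      forall x y, w x y = w y x, forall x y, e x y -> 0 <= w x y &
      connected_graph e] /\
      forall x p, uniq (x :: p) -> (2 <= size p)%N -> path e x p ->
        ~~ e (last x p) x.

Definition tdist (V : finType) (T : dtree V) (x y : V) : R :=
  gdist (@tE V T) (@tW V T) (tEmb T x) (tEmb T y).

Definition dominating_tree (V : finType) (e : rel V) (w : V -> V -> R)
    (T : dtree V) : Prop :=
  [/\ is_tree (@tE V T) (@tW V T), injective (tEmb T) &
      forall x y, gdist e w x y <= tdist T x y].

Definition tree_cover (V : finType) (e : rel V) (w : V -> V -> R)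
    (Ts : seq (dtree V)) (beta : R) : Prop :=
  (forall T, List.In T Ts -> dominating_tree e w T) /\
  (forall x y, exists T, List.In T Ts /\ tdist T x y <= gdist e w x y + beta).

Definition bounded_cover (V : finType) (Ts : seq (dtree V)) (D : R) : Prop :=
  forall T, List.In T Ts -> gdiam (@tE V T) (@tW V T) <= D.

End Graphs.

(* Main.v *)
Require Import Defs.
From HB Require Import structures.
From mathcomp Require Import all_boot all_order all_algebra.
From mathcomp Require Import reals.
From mathcomp Require Import zify lra.
Import Order.TTheory GRing.Theory Num.Theory.

(** Call a vertex of the cluster graph on a short path [C_0, ..., C_l] a hub of
    the path if a map [phi] from a small family sends both [C_0] and [C_l] to it.
    A map [phi] gives a tree: join every vertex [x] to a vertex [s] of the cluster
    [phi (cluster of x)] by an edge of length [d(x, s)], and join all these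
    centres to a common root.  If the hub meets the path [pi], then going through
    its centre costs only [+O(eps * Delta)].

    The family of maps comes from a decomposition of the [K_r]-minor-free cluster
    graph into bags: repeatedly take a component of the remaining graph and remove
    from it a union of BFS geodesics from one vertex to each of the earlier bags
    adjacent to the component.  Those bags are pairwise adjacent, so together
    with the component they form a clique minor and there are fewer than [r - 1]
    of them.  The resulting bag graph is chordal, so the lowest bag of a path with
    at most [h] edges is reached from both ends by descending chains of length at
    most [h]; at most [r ^ h] bags are reachable in this way, and a greedy
    colouring separates them.  Within a bag, the index of a geodesic and the BFS
    level modulo [2 * h + 1] determine a vertex at distance at most [h]. *)

Set Implicit Arguments. Unset Strict Implicit. Unset Printing Implicit Defensive.
Local Open Scope nat_scope.

(** * Hop distance and induced subgraphs *)

Section Hops.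
Variables (K : finType) (e : rel K).

Definition hop n x y := [exists p : n.-tuple K, path e x p && (last x p == y)].

Lemma hopP n x y :
  reflect (exists p, [/\ path e x p, last x p = y & size p = n]) (hop n x y).
Proof.
apply: (iffP existsP) => [[p /andP[pp /eqP lp]]|[p [pp lp /eqP sp]]].
  by exists p; rewrite size_tuple.
by exists (Tuple sp); rewrite /= pp lp eqxx.
Qed.

Lemma hop_connect x y : connect e x y -> exists n, hop n x y.
Proof. by case/connectP => p pp ->; exists (size p); apply/hopP; exists p. Qed.

(** The value is [0] for unreachable [x]; wherever the value matters, connectivity or a path is at
    hand. *)
Definition hopdist u x :=
  if @idP (connect e u x) is ReflectT c then ex_minn (hop_connect c) else 0.

Lemma hopdist_path u x : connect e u x ->
  exists p, [/\ path e u p, last u p = x & size p = hopdist u x].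
Proof.
rewrite /hopdist; case: {-}_ / idP => // c _.
by case: ex_minnP => m /hopP.
Qed.

Lemma hopdist_min u p : path e u p -> hopdist u (last u p) <= size p.
Proof.
rewrite /hopdist; case: {-}_ / idP => // c pp.
by case: ex_minnP => m _; apply; apply/hopP; exists p.
Qed.

Lemma hopdist_lip u x p :
  connect e u x -> path e x p -> hopdist u (last x p) <= hopdist u x + size p.
Proof.
case/hopdist_path => q [pq <- <-] pp.
by rewrite -size_cat -last_cat hopdist_min // cat_path pq.
Qed.

(** A shorter way to [x], continued along the rest of [p], would beat [p]. A geodesic thus meets
    each BFS level at most once. *)
Lemma geodesic_nth u p x : path e u p -> size p = hopdist u (last u p) ->
  x \in u :: p -> x = nth u (u :: p) (hopdist u x).
Proof.
move=> pp sp xp; set k := index x (u :: p).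
have kp : k <= size p by have := xp; rewrite -index_mem.
have lk : last u (take k p) = x.
  rewrite (last_nth u) size_take_min (minn_idPl kp) -[u :: take k p]/(take k.+1 (u :: p)).
  by rewrite nth_take // nth_index.
have /andP[pt pd] : path e u (take k p) && path e x (drop k p).
  by rewrite -{1}lk -cat_path cat_take_drop.
have cx : connect e u x by apply/connectP; exists (take k p).
have le1 : hopdist u x <= k.
  by rewrite -lk (leq_trans (hopdist_min pt)) // size_take_min geq_minl.
have := hopdist_lip cx pd.
rewrite -{1}lk -last_cat cat_take_drop -sp size_drop => le2.
have -> : hopdist u x = k by lia.
by rewrite nth_index.
Qed.

Lemma connect_closed (A : {set K}) x y :
  (forall s t, s \in A -> e s t -> t \in A) -> x \in A -> connect e x y -> y \in A.
Proof.
move=> cl xA /connectP[p pp ->]; elim: p x xA pp => //= s p IH x xA /andP[xs pp].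
exact: IH (cl _ _ xA xs) pp.
Qed.

End Hops.

Section Induced.
Variables (K : finType) (e : rel K).
Hypothesis sym_e : forall x y, e x y = e y x.

Lemma induced_sym (A : {set K}) x y : induced e A x y = induced e A y x.
Proof. by rewrite /induced /= sym_e [(x \in A) && _]andbC. Qed.

Lemma connect_induced_sym (A : {set K}) x y :
  connect (induced e A) x y = connect (induced e A) y x.
Proof. exact/sym_connect_sym/induced_sym. Qed.

Lemma connect_inducedS (A B : {set K}) x y : A \subset B ->
  connect (induced e A) x y -> connect (induced e B) x y.
Proof.
move=> AB; apply: connect_sub => s t /and3P[st sA tA]; apply: connect1.
by rewrite /induced /= st !(subsetP AB).
Qed.

Lemma connect_induced_mem (A : {set K}) x y : x \in A ->
  connect (induced e A) x y -> y \in A.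
Proof. by apply: connect_closed => s t _ /and3P[]. Qed.

Lemma path_induced (A : {set K}) x p : path e x p -> all [in A] (x :: p) ->
  path (induced e A) x p.
Proof.
elim: p x => //= y p IH x /andP[xy pp] /and3P[xA yA pA].
by rewrite /induced /= xy xA yA IH //= yA.
Qed.

Lemma path_induced_sub (A : {set K}) x p : path (induced e A) x p -> path e x p.
Proof. by apply: sub_path => s t /and3P[]. Qed.

End Induced.

(** * Decomposition into bags of geodesics *)

Section Decomposition.
Variables (K : finType) (e : rel K) (r : nat).
Hypothesis sym_e : forall x y, e x y = e y x.
Hypothesis minor_free : ~ has_K_minor e r.

Definition upset (b : K -> nat) m := [set y | m <= b y].
Definition bag (b : K -> nat) j := [set x | b x == j].

(** [upset b j] is the graph left when bag [j] is chosen, [lev] the BFS level and [lab] the index of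
    a geodesic. The first two clauses serve the descent through bags, the other three the
    identification of a vertex inside a bag. *)
Definition good_bag (b lev lab : K -> nat) j : Prop :=
  [/\ forall x y, b x = j -> b y = j -> connect (induced e (upset b j)) x y,
      exists2 s : seq nat, size s < r &
        forall x z y, b x = j -> connect (induced e (upset b j)) x z -> e z y ->
          b y < j -> b y \in s,
      forall x y, b x = j -> b y = j -> lab x = lab y -> lev x = lev y -> x = y,
      forall x, b x = j -> lab x <= r
    & forall x p, b x = j -> path (induced e (upset b j)) x p ->
        b (last x p) = j -> lev (last x p) <= lev x + size p].

Definition connected_bag (b : K -> nat) j :=
  bag b j != set0 /\
  forall u v, u \in bag b j -> v \in bag b j -> connect (induced e (bag b j)) u v.

Definition adjacent_bags (b : K -> nat) i j :=
  exists u v, [/\ b u = i, b v = j & e u v].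

(** The invariant behind the clique minor: settled bags that touch one component of the unsettled
    vertices are pairwise adjacent. The vertex [x] only names that component. *)
Definition clique_below (b : K -> nat) n := forall x z z' y y', b x = n ->
  connect (induced e (upset b n)) x z -> connect (induced e (upset b n)) x z' ->
  e z y -> e z' y' -> b y < n -> b y' < n -> b y <> b y' ->
  adjacent_bags b (b y) (b y').

Lemma minor_free_gt0 : 0 < r.
Proof.
case: r minor_free => // nm; case: nm; exists (fun=> set0).
by split; case.
Qed.

(** Bag [j] is judged only by data on bags up to [j] and by which vertices come later, so splitting
    the later part preserves it. *)
Lemma good_bag_ext b lev lab b' lev' lab' j :
  (forall x, b x <= j -> [/\ b' x = b x, lev' x = lev x & lab' x = lab x]) ->
  (forall x, j < b x -> j < b' x) ->
  good_bag b lev lab j -> good_bag b' lev' lab' j.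
Proof.
move=> hle hgt [g1 [s ss g2] g3 g4 g5].
have eb x : b' x = j -> [/\ b x = j, lev' x = lev x & lab' x = lab x].
  by case: (leqP (b x) j) => [/hle [-> -> ->]|/hgt] //; lia.
have up : upset b' j = upset b j.
  apply/setP=> x; rewrite !inE; case: (leqP (b x) j) => [/hle[-> //]|lt].
  by rewrite (ltnW lt) (ltnW (hgt _ lt)).
have lt' x : b' x < j -> b' x = b x /\ b x < j.
  by case: (leqP (b x) j) => [/hle [-> _ _]|/hgt] //; lia.
split; rewrite ?up.
- by move=> x y /eb[+ _ _] /eb[+ _ _]; exact: g1.
- exists s => // x z y /eb[bx _ _] cz ezy /lt'[-> lt]; exact: g2 bx cz ezy lt.
- by move=> x y /eb[bx -> ->] /eb[by_ -> ->]; exact: g3.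
- by move=> x /eb[bx _ ->]; exact: g4.
- by move=> x p /eb[bx -> _] pp /eb[bl -> _]; exact: g5.
Qed.

(* The component together with the bags below it is a clique minor. *)
Lemma clique_below_size (b : K -> nat) n (s : seq nat) u :
  (forall j, j < n -> connected_bag b j) ->
  clique_below b n -> b u = n -> (forall x, b x <= n) -> uniq s ->
  (forall j, j \in s -> j < n /\ exists z y,
     [/\ connect (induced e (upset b n)) u z, e z y & b y = j]) ->
  (size s).+1 < r.
Proof.
move=> cb cl bu bn us hs; rewrite ltnNge; apply/negP => rs.
apply: minor_free.
pose C := [set z | connect (induced e (upset b n)) u z].
have uU : u \in upset b n by rewrite inE bu.
have CU z : z \in C -> b z = n.
  rewrite inE => /(connect_induced_mem uU); rewrite inE => nz.
  by apply/eqP; rewrite eqn_leq bn.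
have eC : induced e (upset b n) =2 induced e (bag b n).
  by move=> x y; rewrite /induced /= !inE ![_ == n]eqn_leq !bn.
(* Branch set [0] is the component of [u], the others are the bags listed in [s]; [r <= (size s).+1]
   ensures that there are enough of them. *)
pose L := C :: [seq bag b j | j <- s].
have ltL (i : 'I_r) : i <= size s by have := ltn_ord i; lia.
have nthL (i : nat) : i < size s -> nth set0 L i.+1 = bag b (nth 0 s i).
  by move=> lt; rewrite /= (nth_map 0).
have inL (i : nat) : i < size s -> nth 0 s i < n /\ exists z y,
     [/\ connect (induced e (upset b n)) u z, e z y & b y = nth 0 s i].
  by move=> lt; apply/hs/mem_nth.
exists (fun i : 'I_r => nth set0 L i); split.
- case=> [] [|i] /= ir.
    by apply/set0Pn; exists u; rewrite inE.
  have lt : i < size s by have := ltL (Ordinal ir).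
  by rewrite (nth_map 0) //; have [/cb[]] := inL _ lt.
- move=> i j; wlog ij : i j / i < j.
    move=> W nij; case: (ltngtP i j) => [lt|lt|/val_inj/eqP]; last by rewrite (negPf nij).
      exact: W.
    by rewrite disjoint_sym; apply: W; rewrite // eq_sym.
  move=> nij; have := ltL j; case: (val j) ij => [//|j'] ij lj.
  rewrite nthL //; have [ltn _] := inL _ lj.
  rewrite -setI_eq0; apply/eqP/setP => x; rewrite [RHS]inE; apply/negP => /setIP[].
  case: (val i) ij => [|i'] ij /=.
    by move=> /CU bx; rewrite inE bx => /eqP; lia.
  have li : i' < size s by apply: leq_trans lj; rewrite ltnW.
  rewrite (nth_map 0) // !inE => /eqP-> /eqP /eqP; rewrite nth_uniq //; lia.
- move=> i x y; have := ltL i; case: (val i) => [|i'] li.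
    rewrite /= !inE => cx cy.
    have cxy : connect (induced e (upset b n)) x y.
      by apply: connect_trans cy; rewrite connect_induced_sym.
    case/connectP: cxy => p pp ->; apply/connectP; exists p => //.
    have xC : x \in C by rewrite inE.
    elim: p x xC pp {cx cy} => //= z p IH x xC /andP[xz pp].
    have zC : z \in C.
      by rewrite inE (connect_trans _ (connect1 xz)) //; rewrite inE in xC.
    by rewrite /induced /= xC zC IH // !andbT; case/and3P: xz.
  by rewrite nthL //; have [/cb[_ H] _] := inL _ li; apply: H.
- have key i j : i != j -> i < size L -> j < size L ->
      exists u0 v, [/\ u0 \in nth set0 L i, v \in nth set0 L j & e u0 v].
    wlog ij : i j / i < j.
      move=> W nij si sj; case: (ltngtP i j) => [lt|lt|/eqP]; last by rewrite (negPf nij).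
        exact: W.
      have [|v [w [v1 w1 vw]]] := W _ _ lt _ sj si; rewrite 1?eq_sym //.
      by exists w, v; rewrite sym_e.
    case: j ij => [//|j] ij nij si; rewrite /= ltnS size_map => lj.
    have [ltj [z [y [cz zy yj]]]] := inL _ lj.
    case: i ij nij si => [|i] ij nij; rewrite /= ?ltnS ?size_map => li.
      by exists z, y; rewrite (nth_map 0) // !inE yj.
    have [lti [z' [y' [cz' zy' yi]]]] := inL _ li.
    have [|||v [w [v1 w1 vw]]] := cl _ _ _ _ _ bu cz' cz zy' zy; rewrite ?yi ?yj //.
      by apply/eqP; rewrite nth_uniq.
    by exists v, w; rewrite !(nth_map 0) // !inE v1 w1 yi yj !eqxx.
  by move=> i j nij; apply: key => //; rewrite /= size_map ltnS ltL.
Qed.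

(** Each geodesic lives in [e'] and stops one edge of [e] short of its bag, because the settled bags
    lie outside the graph [e'] of the construction. *)
Lemma geodesics_to (b : K -> nat) (e' : rel K) u (s : seq nat) :
  (forall j, j \in s -> exists z y, [/\ connect e' u z, e z y & b y = j]) ->
  exists gs : seq (seq K), [/\ size gs = size s,
    forall p, p \in gs -> path e' u p /\ size p = hopdist e' u (last u p)
  & forall j, j \in s -> exists2 p, p \in gs & exists2 y, e (last u p) y & b y = j].
Proof.
elim: s => [|j s IH] hs; first by exists [::].
have [|gs [sz g1 g2]] := IH; first by move=> k ks; apply: hs; rewrite inE ks orbT.
have [z [y [cz zy yj]]] := hs j (mem_head _ _).
have [p [pp lp sp]] := hopdist_path cz.
exists (p :: gs); split; first by rewrite /= sz.
- by move=> q; rewrite inE => /orP[/eqP->|/g1 //]; rewrite lp.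
- move=> k; rewrite inE => /orP[/eqP->|/g2[q qg hq]].
    by exists p; [exact: mem_head | exists y; rewrite ?lp].
  by exists q; rewrite // inE qg orbT.
Qed.

(** Bags below [n] are final and bag [n] holds the vertices not yet placed, at most [k] of them. One
    round keeps a part of one component as bag [n] and moves all other unplaced vertices to
    [n.+1]. *)
Lemma decomposition_from k (b lev lab : K -> nat) n :
  #|bag b n| <= k -> (forall x, b x <= n) ->
  (forall j, j < n -> good_bag b lev lab j) ->
  (forall j, j < n -> connected_bag b j) ->
  clique_below b n ->
  exists b' lev' lab', forall j, good_bag b' lev' lab' j.
Proof.
elim: k b lev lab n => [|k IH] b lev lab n card bn good conn cliq.
  have bnF x : b x < n.
    rewrite ltn_neqAle bn andbT; apply/eqP => bx.
    move: card; rewrite leqn0 cards_eq0 => /eqP/setP/(_ x).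
    by rewrite !inE bx eqxx.
  exists b, lev, lab => j; case: (ltnP j n) => [/good //|nj].
  (* No vertex is left, so every bag from [n] on is empty and its conditions are vacuous. *)
  have F x : b x <> j by have := bnF x; lia.
  split; try by [move=> x y /F | move=> x /F | move=> x p /F].
  by exists [::]; [exact: minor_free_gt0 | move=> x z y /F].
have [bag0|[u]] := set_0Vmem (bag b n).
  by apply: (IH b lev lab n) => //; rewrite bag0 cards0.
rewrite inE => /eqP bu.
pose U := upset b n; pose e' := induced e U.
have bU x : (x \in U) = (b x == n) by rewrite inE eqn_leq bn.
have uU : u \in U by rewrite bU bu.
pose s := undup [seq b y | y <- enum K &
  (b y < n) && [exists z, connect e' u z && e z y]].
have sP z y : connect e' u z -> e z y -> b y < n -> b y \in s.
  move=> cz zy lt; rewrite mem_undup; apply: map_f.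
  by rewrite mem_filter lt mem_enum andbT; apply/existsP; exists z; rewrite cz.
have hs j : j \in s -> j < n /\ exists z y, [/\ connect e' u z, e z y & b y = j].
  rewrite mem_undup => /mapP[y]; rewrite mem_filter.
  move=> /andP[/andP[lt /existsP[z /andP[cz zy]]] _] ->.
  by split=> //; exists z, y.
have ltsr : (size s).+1 < r by apply: clique_below_size hs; rewrite // ?undup_uniq.
have [gs [szg g1 g2]] := geodesics_to (fun j js => (hs j js).2).
(* The new bag. The disjunct [x == u] matters when no settled bag touches the component: then [gs]
   is empty and the bag is [u] alone. *)
pose H x := (x == u) || has (fun p => x \in u :: p) gs.
have HP p x : p \in gs -> x \in u :: p -> H x.
  by move=> pg xp; rewrite /H; apply/orP; right; apply/hasP; exists p.
have HC x : H x -> connect e' u x.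
  case/orP => [/eqP-> //|/hasP[p /g1[pp _] xp]].
  case/splitPl: xp pp => p1 p2 <-; rewrite cat_path => /andP[pp _].
  by apply/connectP; exists p1.
have HU x : H x -> b x = n.
  by move=> /HC /(connect_induced_mem uU); rewrite bU => /eqP.
pose b' x := if b x < n then b x else if H x then n else n.+1.
pose lev' x := if b x < n then lev x else hopdist e' u x.
(* The first geodesic through [x]. On a vertex of the new bag [find] yields its default [size gs]
   only if [gs] is empty, and then the vertex is [u]. *)
pose lab' x := if b x < n then lab x else find (fun p => x \in u :: p) gs.
have b'lt x : b x < n -> b' x = b x by rewrite /b' => ->.
have b'H x : H x -> b' x = n by move=> Hx; rewrite /b' (HU _ Hx) ltnn Hx.
have ltb' x : b' x < n -> b x < n.
  by rewrite /b'; case: ifP => // _; case: ifP; lia.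
have eqb' x : b' x = n -> H x.
  by rewrite /b'; case: ifP => [|_]; [lia | case: ifP => // _; lia].
have b'n x : b' x = n -> ~~ (b x < n) by move=> /eqb' /HU ->; rewrite ltnn.
have up' : upset b' n = U.
  apply/setP => x; rewrite !inE leqNgt [RHS]leqNgt; congr negb.
  by apply/idP/idP => [/ltb'|lt] //; rewrite b'lt.
have bag' j : j < n -> bag b' j = bag b j.
  move=> jn; apply/setP => x; rewrite !inE; apply/eqP/eqP => [bx|bx].
    by rewrite -b'lt // ltb' // bx.
  by rewrite b'lt bx.
have Hu : H u by rewrite /H eqxx.
apply: (IH b' lev' lab' n.+1).
(* The measure drops because [u] leaves the unplaced vertices. *)
- rewrite -ltnS; apply: leq_trans card; apply/proper_card/properP; split.
    apply/subsetP => x; rewrite !inE /b'; case: ifP => [lt|nlt _]; first lia.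
    by rewrite eqn_leq bn leqNgt nlt.
  by exists u; rewrite !inE ?bu // b'H // neq_ltn leqnn.
- by move=> x; rewrite /b'; case: ifP => [|_]; [lia | case: ifP].
- move=> j; rewrite ltnS leq_eqVlt => /orP[/eqP->|jn]; last first.
    apply: good_bag_ext (good _ jn) => x bx.
      have lt : b x < n by lia.
      by rewrite /b' /lev' /lab' lt.
    by rewrite /b'; case: ifP => // _; case: ifP => _; lia.
  split; rewrite ?up'.
  + move=> x y /eqb' /HC cx /eqb' /HC; apply: connect_trans.
    by rewrite connect_induced_sym.
  + exists s; first exact: ltnW.
    move=> x z y /eqb' /HC cx cz zy /ltb' lt; rewrite b'lt //.
    exact: sP (connect_trans cx cz) zy lt.
  + move=> x y bx by_; rewrite /lab' /lev' !(negPf (b'n _ _)) // => El Ev.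
    have [hx|nx] := boolP (has (fun p => x \in u :: p) gs).
      have hy : has (fun p => y \in u :: p) gs by rewrite has_find -El -has_find.
      have [pp sp] := g1 _ (mem_nth [::] (eq_ind _ is_true hx _ (has_find _ _))).
      rewrite (geodesic_nth pp sp (nth_find [::] hx)) Ev.
      by symmetry; apply: (geodesic_nth pp sp); rewrite El (nth_find [::] hy).
    have ny : ~~ has (fun p => y \in u :: p) gs by rewrite has_find -El -has_find.
    by have:= eqb' _ bx; have := eqb' _ by_;
      rewrite /H (negPf nx) (negPf ny) !orbF => /eqP-> /eqP->.
  + move=> x bx; rewrite /lab' (negPf (b'n _ bx)).
    by apply: leq_trans (find_size _ _) _; rewrite szg ltnW // ltnW.
  + move=> x p bx pp bl; rewrite /lev' !(negPf (b'n _ _)) //.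
    by apply: hopdist_lip => //; apply/HC/eqb'.
- move=> j; rewrite ltnS leq_eqVlt => /orP[/eqP->|jn]; last first.
    by rewrite /connected_bag bag' //; apply: conn.
  split; first by apply/set0Pn; exists u; rewrite inE b'H.
  have cH x : H x -> connect (induced e (bag b' n)) u x.
    case/orP => [/eqP-> //|/hasP[p pg xp]]; have [pp _] := g1 _ pg.
    have hH z : z \in u :: p -> z \in bag b' n by move=> zp; rewrite inE b'H ?(HP p).
    case/splitPl: xp pp hH => p1 p2 <-; rewrite cat_path => /andP[pp _] hH.
    apply/connectP; exists p1 => //; apply: path_induced; first exact: path_induced_sub pp.
    by apply/allP => z zp; apply: hH; rewrite -cat_cons mem_cat zp.
  move=> x y; rewrite !inE => /eqP/eqb'/cH cx /eqP/eqb'/cH; apply: connect_trans.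
  by rewrite connect_induced_sym.
(* A component left at stage [n.+1] lies in one left at stage [n], so two old bags are adjacent by
   [cliq]; only pairs with bag [n] are new. *)
- move=> x z z' y y' bx cz cz' zy zy' ly ly' nyy.
  have sub : upset b' n.+1 \subset U.
    by rewrite -up'; apply/subsetP => v; rewrite !inE => /ltnW.
  have xU : x \in U by rewrite (subsetP sub) // inE bx.
  have bxn : b x = n by apply/eqP; rewrite -bU.
  move/(connect_inducedS sub): cz => cz; move/(connect_inducedS sub): cz' => cz'.
  (* A remaining component that touches bag [n] lies in the component of [u]. The old bag was
     therefore a target, and its geodesic ends in bag [n] next to it. *)
  have main a a' c c' : connect e' x a -> connect e' x a' -> e a c -> e a' c' ->
      b' c = n -> b' c' < n -> adjacent_bags b' n (b' c').
    move=> ca ca' ac ac' bc /ltb' lt; rewrite b'lt //.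
    have cua : connect e' u a.
      apply: connect_trans (HC _ (eqb' _ bc)) (connect1 _).
      rewrite /e' /induced /= sym_e ac bU (HU _ (eqb' _ bc)) eqxx.
      exact: connect_induced_mem ca.
    have cua' : connect e' u a'.
      by apply: connect_trans cua (connect_trans _ ca'); rewrite connect_induced_sym.
    have [p pg [v pv bv]] := g2 _ (sP _ _ cua' ac' lt).
    exists (last u p), v; split => //; last by rewrite b'lt bv.
    by apply/b'H/(HP p) => //; apply: mem_last.
  move: ly ly'; rewrite !ltnS leq_eqVlt [b' y' <= n]leq_eqVlt.
  case/orP=> [/eqP Ey|ly]; case/orP=> [/eqP Ey'|ly']; first by rewrite Ey Ey' in nyy.
  + by rewrite Ey; apply: main cz cz' zy zy' Ey ly'.
  + rewrite Ey'; have [v [w [bv bw vw]]] := main _ _ _ _ cz' cz zy' zy Ey' ly.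
    by exists w, v; rewrite sym_e.
  + have l1 := ltb' _ ly; have l2 := ltb' _ ly'.
    rewrite !b'lt // in nyy *.
    have [v [w [bv bw vw]]] := cliq _ _ _ _ _ bxn cz cz' zy zy' l1 l2 nyy.
    by exists v, w; rewrite !b'lt ?bv ?bw.
Qed.

Lemma decomposition : exists b lev lab, forall j, good_bag b lev lab j.
Proof.
pose z (_ : K) := 0.
by apply: (@decomposition_from #|bag z 0| z z z 0).
Qed.

End Decomposition.

(** * Hubs of short paths *)

(** At most [B] of the [B.+1] colours are forbidden when an index is reached. *)
Lemma greedy_colouring (L : nat -> seq nat) (B : nat) (n : nat) :
  (forall m, size (L m) <= B) ->
  exists col : nat -> nat, (forall m, col m <= B) /\
    forall m j, m < n -> j \in L m -> j < m -> col j <> col m.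
Proof.
move=> hL; elim: n => [|n [col [cB hc]]]; first by exists (fun=> 0).
have [c cB' cN] : exists2 c, c <= B & c \notin [seq col j | j <- L n].
  have [/allP sub|] := boolP (all [in [seq col j | j <- L n]] (iota 0 B.+1)).
    have := uniq_leq_size (iota_uniq 0 B.+1) sub.
    by rewrite size_iota size_map => /(fun h => leq_trans h (hL n)); rewrite ltnn.
  case/allPn => c; rewrite mem_iota add0n ltnS => cB' cN.
  by exists c.
exists (fun m => if m == n then c else col m); split.
  by move=> m; case: ifP.
move=> m j; rewrite ltnS leq_eqVlt => /orP[/eqP->|mn] jL jm.
  rewrite eqxx (ltn_eqF jm) => Ec; case/negP: cN.
  by rewrite -Ec map_f.
by rewrite (ltn_eqF mn) (ltn_eqF (ltn_trans jm mn)); apply: hc.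
Qed.

Section Hubs.
Variables (K : finType) (e : rel K) (r : nat).
Hypothesis sym_e : forall x y, e x y = e y x.
Variables b lev lab : K -> nat.
Hypothesis good : forall j, good_bag e r b lev lab j.

Let conn m := connect (induced e (upset b m)).

(** Neighbours of the whole component of bag [m] count, not just those of bag [m]; this fill-in
    makes the bag graph chordal. *)
Definition below m : seq nat :=
  undup [seq b y | y <- enum K & (b y < m) &&
           [exists x, exists z, [&& b x == m, conn m x z & e z y]]].

Lemma belowP m j : reflect
  (exists x z y, [/\ b x = m, conn m x z, e z y, b y < m & b y = j])
  (j \in below m).
Proof.
rewrite mem_undup; apply: (iffP mapP) => [[y]|[x [z [y [bx cz zy lt <-]]]]].
  rewrite mem_filter => /andP[/andP[lt /existsP[x /existsP[z /and3P[/eqP bx cz zy]]]] _] ->.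
  by exists x, z, y.
exists y => //; rewrite mem_filter lt mem_enum andbT /=.
by apply/existsP; exists x; apply/existsP; exists z; rewrite bx eqxx cz zy.
Qed.

Lemma below_size m : size (below m) < r.
Proof.
have [_ [s ss hs] _ _ _] := good m; apply: leq_ltn_trans ss.
apply: uniq_leq_size => [|j /belowP[x [z [y [bx cz zy lt <-]]]]].
  exact: undup_uniq.
exact: hs bx cz zy lt.
Qed.

Lemma below_edge x y : e x y -> b y < b x -> b y \in below (b x).
Proof. by move=> xy lt; apply/belowP; exists x, x, y; rewrite /conn connect0. Qed.

Lemma below_ltn m j : j \in below m -> j < m.
Proof. by case/belowP=> x [z [y [_ _ _ lt <-]]]. Qed.

(* Chordality of the bag graph: the component of the [i]-th bag lies in the
   component of every bag [k] below it. *)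
Lemma below_chordal i j k :
  j \in below i -> k \in below i -> j < k -> j \in below k.
Proof.
case/belowP => x [z [y [bx cz zy lty yj]]] /belowP[x' [z' [y' [bx' cz' zy' lty' yk]]]] jk.
have ki : k < i by rewrite -yk.
have [g _ _ _ _] := good i.
have ups : upset b i \subset upset b k.
  by apply/subsetP => v; rewrite !inE; apply: leq_trans; apply: ltnW.
apply/belowP; exists y', z, y; rewrite yj; split=> //.
have z'k : k <= b z'.
  have : z' \in upset b i by apply: connect_induced_mem cz'; rewrite inE bx'.
  by rewrite inE => /(leq_trans _)->//; apply: ltnW.
apply: (@connect_trans _ _ z').
  by apply: connect1; rewrite /induced /= sym_e zy' !inE yk leqnn.
apply: (connect_inducedS ups); apply: connect_trans cz.
apply: connect_trans (g _ _ bx' bx).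
by rewrite connect_induced_sym.
Qed.

Fixpoint reach t m : seq nat :=
  if t is t'.+1 then m :: flatten [seq reach t' j | j <- below m] else [:: m].

Lemma reachS t m j :
  reflect (j = m \/ exists2 k, k \in below m & j \in reach t k) (j \in reach t.+1 m).
Proof.
rewrite /= inE; apply: (iffP orP) => [[/eqP|/flatten_mapP]|[->|]]; try by [left | right].
by move=> h; right; apply/flatten_mapP.
Qed.

Lemma reach_refl t m : m \in reach t m.
Proof. by case: t => [|t]; rewrite /= inE eqxx. Qed.

Lemma reach_mono s t m j : s <= t -> j \in reach s m -> j \in reach t m.
Proof.
elim: t s m => [|t IH] [|s] m st //; first by rewrite inE => /eqP->; exact: reach_refl.
case/reachS => [->|[k km jk]]; apply/reachS; first by left.
by right; exists k => //; apply: IH jk.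
Qed.

(** Since [below m] has fewer than [r] members, the count is at most [1 + (r - 1) * r ^ t]; the
    strict bound pays for [m] itself. *)
Lemma reach_size t m : size (reach t m) <= r ^ t.
Proof.
have r0 : 0 < r by apply: leq_ltn_trans (below_size 0).
elim: t m => //= t IH m; rewrite size_flatten /shape -map_comp expnS.
have: sumn [seq size (reach t j) | j <- below m] <= size (below m) * r ^ t.
  elim: (below m) => //= j s IHs; rewrite mulSn.
  by apply: leq_add.
have := below_size m; have : 0 < r ^ t by rewrite expn_gt0 r0.
move: (size _) (r ^ t) => p q q0 pr h.
apply: (@leq_trans (1 + p * q)); first by rewrite add1n ltnS.
by apply: (@leq_trans (q + p * q)); [rewrite leq_add2r | rewrite -mulSn leq_mul2r pr orbT].
Qed.

(** Let [i'] be the first step of the chain from [i] to [j]. If [i' < k], chordality lets [i'] be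
    the first step from [k] as well; if [k < i'], then [k] is below [i'] and the shorter chain from
    [i'] slides on. *)
Lemma reach_slide t i j k : k \in below i -> j \in reach t i -> j <= k -> j \in reach t k.
Proof.
elim: t i => [|t IH] i ki.
  by rewrite inE => /eqP->; rewrite leqNgt below_ltn.
have ltk := below_ltn ki.
case/reachS => [->|[i' i'i ji'] jk]; first by rewrite leqNgt ltk.
have [lt|lt|E] := ltngtP i' k; last by rewrite -E; apply: reach_mono ji'.
  by apply/reachS; right; exists i' => //; apply: below_chordal i'i ki lt.
apply: (@reach_mono t) => //; apply: IH ji' jk.
exact: below_chordal ki i'i lt.
Qed.

Lemma reach_le t m j : j \in reach t m -> j <= m.
Proof.
elim: t m => [|t IH] m; first by rewrite inE => /eqP->.
by case/reachS => [->|[k /below_ltn km /IH jk]] //; lia.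
Qed.

(** Slide along the chain from [i] to [k]. Of two bags reachable from one bag, the higher thus
    reaches the lower, and the colouring tells them apart. *)
Lemma reach_pair s t i j k :
  k \in reach t i -> j \in reach s i -> j <= k -> j \in reach s k.
Proof.
elim: t i => [|t IH] i; first by rewrite inE => /eqP->.
case/reachS => [->|[i' i'i ki'] ji jk] //.
apply: (IH i') => //; apply: reach_slide i'i ji _.
exact: leq_trans jk (reach_le ki').
Qed.

(** Build the chain from the far end: an edge going down prolongs it, an edge going up is absorbed
    by [reach_slide], which applies because no vertex lies below [m]. *)
Lemma path_reach x p m : path e x p -> all (fun z => m <= b z) (x :: p) ->
  b (last x p) = m -> m \in reach (size p) (b x).
Proof.
elim: p x => [|y p IH] x /=; first by move=> _ _ ->; rewrite inE.
case/andP => xy pp /andP[mx al] bl; have {IH pp bl} h := IH y pp al bl.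
have [lt|lt|E] := ltngtP (b x) (b y).
- apply: (@reach_mono (size p) (size p).+1) => //; apply: reach_slide h mx.
  by apply: below_edge => //; rewrite sym_e.
- by apply/reachS; right; exists (b y) => //; apply: below_edge.
- by rewrite E; apply: (@reach_mono (size p) (size p).+1).
Qed.

(** * Recovering a hub from colour, label and level residue *)

Variable h : nat.
Variable col : nat -> nat.
Hypothesis colP : forall x j, j \in reach h (b x) -> j < b x -> col j <> col (b x).

(** The walk stays in the graph left when the bag of [x] was chosen, since [lev] is controlled only
    along walks there. *)
Definition near (a x : K) :=
  [exists n : 'I_h.+1, hop (induced e (upset b (b x))) n a x].

Lemma nearP a x : reflect
  (exists p, [/\ path (induced e (upset b (b x))) a p, last a p = x & size p <= h])
  (near a x).
Proof.
apply: (iffP existsP) => [[n /hopP[p [pp lp sp]]]|[p [pp lp sp]]].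
  by exists p; split=> //; rewrite sp -ltnS ltn_ord.
by exists (inord (size p)); rewrite inordK ?ltnS //; apply/hopP; exists p.
Qed.

Definition hub_cand g q c (a x : K) :=
  [&& b x \in reach h (b a), col (b x) == g, lab x == q,
      lev x %% (2 * h).+1 == c & near a x].

(** The colour fixes the bag by [reach_pair] and [colP]. Then [lab] fixes the geodesic, and the
    residue fixes the level, since two candidates are joined through [a] by a walk of at most
    [2 * h] steps. *)
Lemma hub_cand_uniq g q c a x y :
  hub_cand g q c a x -> hub_cand g q c a y -> x = y.
Proof.
case/and5P=> rx /eqP gx /eqP qx /eqP cx nx /and5P[ry /eqP gy /eqP qy /eqP cy ny].
have E : b x = b y.
  have [lt|lt|//] := ltngtP (b x) (b y).
    by case: (colP (reach_pair ry rx (ltnW lt)) lt); rewrite gx gy.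
  by case: (colP (reach_pair rx ry (ltnW lt)) lt); rewrite gx gy.
have [_ _ g3 _ g5] := good (b y).
apply: g3 => //; first by rewrite qx qy.
have lip u v : b u = b y -> b v = b y -> near a u -> near a v -> lev v <= lev u + (2 * h).
  move=> bu bv /nearP[p [pp lp sp]] /nearP[p' [pp' lp' sp']].
  rewrite bu in pp; rewrite bv in pp'.
  have symA : symmetric (induced e (upset b (b y))) by exact: induced_sym.
  have := rev_path (induced e (upset b (b y))) a p; rewrite lp.
  rewrite (eq_path (e' := induced e (upset b (b y)))) => [rp|s t]; last exact: symA.
  rewrite pp in rp.
  have lr : last u (rev (belast a p)) = a.
    by rewrite -lp; case: (p) => //= s q'; rewrite rev_cons last_rcons.
  have := g5 u (rev (belast a p) ++ p') bu.
  rewrite cat_path last_cat lr lp' rp pp' => /(_ isT bv) /leq_trans; apply.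
  by rewrite leq_add2l size_cat size_rev size_belast mul2n -addnn leq_add.
have L1 := lip _ _ E erefl nx ny; have L2 := lip _ _ erefl E ny nx.
wlog le : x y {rx gx qx ry gy qy E g5 lip} cx cy {nx ny} L1 L2 / lev x <= lev y.
  by move=> W; have [/W->//|/ltnW/W->] := leqP (lev x) (lev y).
have := etrans cx (esym cy) => /eqP; rewrite eq_sym eqn_mod_dvd // => dv.
apply/eqP; rewrite eqn_leq le -subn_eq0 /=.
case: (posnP (lev y - lev x)) => [//|/dvdn_leq/(_ dv)]; lia.
Qed.

(** Without a candidate the value [a] is a mere filler. *)
Definition hub g q c : {ffun K -> K} :=
  [ffun a => odflt a [pick x | hub_cand g q c a x]].

Lemma hub_eq g q c a x : hub_cand g q c a x -> hub g q c a = x.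
Proof.
move=> hx; rewrite ffunE; case: pickP => [y hy|/(_ x)]; last by rewrite hx.
exact: hub_cand_uniq hy hx.
Qed.

(** Take [x] in the lowest bag on the path: both halves then stay in [upset b (b x)], so [x] is a
    candidate from either end. *)
Lemma hub_path a p : path e a p -> size p <= h -> exists x,
  [/\ x \in a :: p,
      hub (col (b x)) (lab x) (lev x %% (2 * h).+1) a = x &
      hub (col (b x)) (lab x) (lev x %% (2 * h).+1) (last a p) = x].
Proof.
move=> pp sp.
have [x xp /allP xmin] := arg_minnP b (mem_head a p).
exists x; case/splitPl: xp pp sp xmin => p1 p2 lp.
rewrite cat_path size_cat last_cat lp -cat_cons all_cat => /andP[P1 P2] sz /andP[A1 A2].
have half u q : path e u q -> all (fun z => b x <= b z) (u :: q) -> last u q = x ->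
    size q <= h -> hub (col (b x)) (lab x) (lev x %% (2 * h).+1) u = x.
  move=> pq al lq sq; apply: hub_eq; rewrite /hub_cand !eqxx /=; apply/andP; split.
    apply: (reach_mono sq); apply: path_reach => //; by rewrite lq.
  apply/nearP; exists q; split=> //; apply: path_induced => //.
  by apply: sub_all al => z; rewrite inE.
split.
- by rewrite mem_cat -lp mem_last.
- by apply: half P1 A1 lp _; apply: leq_trans sz; apply: leq_addr.
- have lr : last (last x p2) (rev (belast x p2)) = x.
    by case: (p2) => //= s q'; rewrite rev_cons last_rcons.
  apply: half lr _.
  + by rewrite rev_path (eq_path (e' := e)) // => s t; apply: sym_e.
  + by rewrite -rev_rcons -lastI all_rev /= leqnn.
  + by rewrite size_rev size_belast; apply: leq_trans sz; apply: leq_addl.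
Qed.

End Hubs.

Theorem hub_family (K : finType) (e : rel K) (r h : nat) :
  (forall x y, e x y = e y x) -> ~ has_K_minor e r ->
  exists F : seq {ffun K -> K}, size F <= 2 ^ ((r + 2) * h.+1) /\
    forall a p, path e a p -> size p <= h ->
      exists phi x, [/\ phi \in F, x \in a :: p, phi a = x & phi (last a p) = x].
Proof.
move=> sym_e nm; have [b [lev [lab good]]] := decomposition sym_e nm.
have [col [colB colP]] := greedy_colouring (\max_(x : K) b x).+1 (reach_size good h).
have colP' x j : j \in reach e b h (b x) -> j < b x -> col j <> col (b x).
  by apply: colP; rewrite ltnS; apply: leq_bigmax.
pose F := [seq hub e b lev lab h col g qc.1 qc.2 | g <- iota 0 (r ^ h).+1,
  qc <- [seq (q, c) | q <- iota 0 r.+1, c <- iota 0 (2 * h).+1]].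
exists F; split.
  (* Colours, labels and residues contribute at most [2 ^ (r * h).+1], [2 ^ r] and [2 ^ h.+1]. *)
  rewrite !size_allpairs !size_iota.
  have lt k : k < 2 ^ k by exact: ltn_expl.
  have l1 : (r ^ h).+1 <= 2 ^ (r * h).+1.
    rewrite expnS mul2n -addnn -addn1 leq_add ?expn_gt0 // expnM.
    by case: (posnP h) => [->//|h0]; rewrite leq_exp2r // ltnW.
  have l3 : (2 * h).+1 <= 2 ^ h.+1 by rewrite expnS; have := lt h; lia.
  apply: leq_trans (leq_mul l1 (leq_mul (lt r) l3)) _.
  by rewrite -!expnD leq_exp2l //; nia.
have iotaP k n : k < n -> k \in iota 0 n by rewrite mem_iota.
move=> a p pp sp; have [x [xp h1 h2]] := hub_path sym_e good colP' pp sp.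
exists (hub e b lev lab h col (col (b x)) (lab x) (lev x %% (2 * h).+1)), x.
split=> //; apply/allpairsP; exists (col (b x), (lab x, lev x %% (2 * h).+1)).
have [_ _ _ g4 _] := good (b x).
split; last by [].
  by apply: iotaP; apply: colB.
by apply: allpairs_f; apply: iotaP; rewrite ?ltn_mod // ltnS g4.
Qed.

(** * Graph distances and trees given by a parent function *)

Local Open Scope ring_scope.

Section Metric.
Variables (R : realType) (V : finType) (e : rel V) (w : V -> V -> R).
Hypothesis sym_e : forall x y, e x y = e y x.
Hypothesis sym_w : forall x y, w x y = w y x.
Hypothesis w_ge0 : forall x y, e x y -> 0 <= w x y.
Hypothesis conn_e : connected_graph e.

Lemma plen_cat x p q : plen w x (p ++ q) = plen w x p + plen w (last x p) q.
Proof. by elim: p x => [|y p IH] x /=; rewrite ?add0r // IH addrA. Qed.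

Lemma plen_ge0 x p : path e x p -> 0 <= plen w x p.
Proof. by elim: p x => //= y p IH x /andP[xy pp]; rewrite addr_ge0 ?w_ge0 ?IH. Qed.

Lemma plen_rev x p : plen w (last x p) (rev (belast x p)) = plen w x p.
Proof.
elim: p x => //= y p IH x.
rewrite rev_cons -cats1 plen_cat IH addrC /= addr0; congr (_ + _).
rewrite sym_w; congr (w _ _).
by case: p {IH} => //= z p; rewrite rev_cons last_rcons.
Qed.

Lemma gdist_le_plen x p : path e x p -> gdist e w x (last x p) <= plen w x p.
Proof.
move=> pp; apply: ge_inf; last by exists p.
by exists 0 => _ [q [pq _ <-]]; apply: plen_ge0.
Qed.

(** Connectivity makes the set of path lengths nonempty, as a lower bound on [inf] requires. *)
Lemma gdist_ge x y c : connect e x y ->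
  (forall p, path e x p -> last x p = y -> c <= plen w x p) -> c <= gdist e w x y.
Proof.
move=> /connectP[p pp lp] H; apply: lb_le_inf; first by exists (plen w x p), p.
by move=> _ [q [pq lq <-]]; apply: H.
Qed.

Lemma gdist_ge0 x y : 0 <= gdist e w x y.
Proof. by apply: gdist_ge => [|p pp _]; [exact: conn_e | exact: plen_ge0]. Qed.

Lemma gdistxx x : gdist e w x x = 0.
Proof.
apply/eqP; rewrite eq_le gdist_ge0 andbT.
exact: (@gdist_le_plen x [::]).
Qed.

Lemma gdist_triangle y x z : gdist e w x z <= gdist e w x y + gdist e w y z.
Proof.
rewrite -lerBlDr; apply: gdist_ge => [|p pp lp]; first exact: conn_e.
rewrite lerBlDr -lerBlDl; apply: gdist_ge => [|q pq lq]; first exact: conn_e.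
rewrite lerBlDl -lq -lp -last_cat -plen_cat; apply: gdist_le_plen.
by rewrite cat_path pp lp.
Qed.

Lemma gdist_sym x y : gdist e w x y = gdist e w y x.
Proof.
have le a b : gdist e w a b <= gdist e w b a.
  apply: gdist_ge => [|p pp lp]; first exact: conn_e.
  have pr : path e a (rev (belast b p)).
    by rewrite -lp rev_path (eq_path (e' := e)) // => s t; apply: sym_e.
  have lr : last a (rev (belast b p)) = b.
    by case: p lp {pp pr} => //= s q _; rewrite rev_cons last_rcons.
  by have := gdist_le_plen pr; rewrite lr -[X in plen _ X]lp plen_rev.
by apply/eqP; rewrite eq_le !le.
Qed.

Lemma gdist_edge x y : e x y -> gdist e w x y <= w x y.
Proof.
move=> xy; have := @gdist_le_plen x [:: y]; rewrite /= addr0; apply.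
by rewrite xy.
Qed.

Lemma gdist_le_gdiam x y : gdist e w x y <= gdiam e w.
Proof.
apply: le_trans (le_bigmax _ _ x).
exact: (le_bigmax _ (fun y => gdist e w x y) y).
Qed.

Lemma gdiam_ge0 : 0 <= gdiam e w.
Proof. exact: bigmax_ge_id. Qed.

(** Fewer paths give a larger infimum, provided some path remains; this turns strong diameter into
    distance in the whole graph. *)
Lemma gdist_induced (C : {set V}) x y : connect (induced e C) x y ->
  gdist e w x y <= gdist (induced e C) w x y.
Proof.
case/connectP => p pp lp; apply: lb_le_inf; first by exists (plen w x p), p.
by move=> _ [q [pq <- <-]]; apply/gdist_le_plen/path_induced_sub/pq.
Qed.

End Metric.

(** * Acyclicity of the graph of a parent function *)

Section ParentTree.
Variables (R : realType) (U : finType) (par : U -> U) (ht : U -> nat).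
Hypothesis ht_par : forall u, par u != u -> (ht (par u) < ht u)%N.

(** Fixed points of [par] act as roots; [u != v] removes their loops. *)
Definition par_rel : rel U := [rel u v | (u != v) && ((par u == v) || (par v == u))].

Lemma par_rel_sym u v : par_rel u v = par_rel v u.
Proof. by rewrite /par_rel /= eq_sym orbC. Qed.

(** Otherwise [u] would be the parent of [v] and hence strictly lower. *)
Lemma par_rel_up u v : par_rel u v -> (ht v <= ht u)%N -> par u = v.
Proof.
case/andP=> nuv /orP[/eqP//|/eqP pv] le.
have := @ht_par v; rewrite pv nuv => /(_ isT); lia.
Qed.

(* Both neighbours on a cycle of a vertex of maximal height are its parent. *)
Lemma par_rel_acyclic x p : uniq (x :: p) -> (2 <= size p)%N -> path par_rel x p ->
  ~~ par_rel (last x p) x.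
Proof.
move=> up sp pp; apply/negP => lx.
have cyc : cycle par_rel (x :: p) by rewrite /= rcons_path pp.
have [z zp zmax] := arg_maxnP ht (mem_head x p).
have [i q Eq] := rot_to zp.
have zmax' : all (fun y => ht y <= ht z)%N (rot i (x :: p)).
  by apply/allP => u; rewrite mem_rot; apply: zmax.
move: cyc up sp zmax'; rewrite -(rot_cycle i) -(rot_uniq i).
rewrite -ltnS -[(size p).+1]/(size (x :: p)) -(size_rot i (x :: p)) Eq.
case: q {Eq} => [|y [|t q]] // cyc; have: path par_rel z (rcons [:: y, t & q] z) by [].
rewrite rcons_path => /andP[/andP[zy _] lz].
move=> /and3P[_ yn _] _ /and3P[_ hy hal].
have /allP al : all (fun y => ht y <= ht z)%N (t :: q) by [].
have hl : (ht (last t q) <= ht z)%N by apply: al; apply: mem_last.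
have yl : y = last t q.
  rewrite -(par_rel_up zy hy); apply: (par_rel_up _ hl).
  by rewrite par_rel_sym.
by move: yn; rewrite yl mem_last.
Qed.
End ParentTree.

(** * From hubs to tree covers *)

Section ClusterMinor.
Variables (V : finType) (e : rel V) (P : {set {set V}}).
Hypothesis sym_e : forall x y, e x y = e y x.
Hypothesis partP : partition P [set: V].
Hypothesis connP : forall C, C \in P -> forall u v, u \in C -> v \in C ->
  connect (induced e C) u v.

Lemma cadj_sym C D : cadj e P C D = cadj e P D C.
Proof.
have half A B : cadj e P A B -> cadj e P B A.
  case/and4P=> AP BP nAB /existsP[x /existsP[y /and3P[xA yB xy]]].
  rewrite /cadj /= AP BP eq_sym nAB; apply/existsP; exists y; apply/existsP; exists x.
  by rewrite xA yB sym_e.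
by apply/idP/idP => /half.
Qed.

Lemma pblock_in x : pblock P x \in P.
Proof. by case/and3P: partP => /eqP cov _ _; rewrite pblock_mem // cov inE. Qed.

Lemma mem_pblock_part x : x \in pblock P x.
Proof. by case/and3P: partP => /eqP cov _ _; rewrite mem_pblock cov inE. Qed.

Lemma pblock_eq C x : C \in P -> x \in C -> pblock P x = C.
Proof. by case/and3P: partP => _ tr _ CP xC; apply: def_pblock. Qed.

(** Each branch set is pulled back to the union of its clusters, which is connected because the
    clusters are. *)
Lemma cadj_minor r (v0 : V) : has_K_minor (cadj e P) r -> has_K_minor e r.
Proof.
(* Sets outside [P] are isolated nodes of [cadj e P], so a lone branch set may contain no cluster.
   For [r <= 1] the vertex [v0] is used instead; for larger [r] an edge to another branch set
   supplies a cluster. *)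
case=> B [ne dis con adj]; have [r2|r2] := ltnP 1 r; last first.
  exists (fun=> [set v0]); split.
  - by move=> i; apply/set0Pn; exists v0; rewrite inE.
  - move=> i j; rewrite -val_eqE /= => nij.
    by have := ltn_ord i; have := ltn_ord j; lia.
  - by move=> i u v; rewrite !inE => /eqP-> /eqP->; apply: connect0.
  - move=> i j; rewrite -val_eqE /= => nij.
    by have := ltn_ord i; have := ltn_ord j; lia.
pose B' (i : 'I_r) := [set x | pblock P x \in B i].
have inB' i C x : C \in P -> C \in B i -> x \in C -> x \in B' i.
  by move=> CP CB xC; rewrite inE (pblock_eq CP xC).
have edge i j : i != j -> exists u v, [/\ u \in B' i, v \in B' j & e u v].
  move=> nij; have [C [D [CB DB]]] := adj _ _ nij.
  case/and4P => CP DP _ /existsP[x /existsP[y /and3P[xC yD xy]]].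
  by exists x, y; rewrite (inB' _ C) ?(inB' _ D).
exists B'; split => //.
- move=> i; have [j nij] : exists j : 'I_r, i != j.
    have lt0 : (0 < r)%N by lia.
    have [/eqP i0|ni] := boolP (i == Ordinal lt0); last by exists (Ordinal lt0).
    by exists (Ordinal r2); rewrite i0.
  by have [x [y [xB _ _]]] := edge _ _ nij; apply/set0Pn; exists x.
- move=> i j nij; rewrite -setI_eq0; apply/eqP/setP => x; rewrite !inE.
  apply/negP => /andP[xi xj]; have := dis _ _ nij.
  by move/disjointFr/(_ xi); rewrite xj.
- have inC i C x y : C \in P -> C \in B i -> x \in C -> y \in C ->
      connect (induced e (B' i)) x y.
    move=> CP CB xC yC; apply: (@connect_inducedS _ _ C); last exact: connP.
    by apply/subsetP => z; apply: inB'.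
  move=> i x y; rewrite !inE => xB yB; have := con i _ _ xB yB.
  case/connectP => p pp lp.
  have {lp} yl : y \in last (pblock P x) p by rewrite -lp mem_pblock_part.
  move: (pblock P x) (pblock_in x) (mem_pblock_part x) xB pp yl => C.
  elim: p C x => [|D p IH] C x CP xC CB /=; first by move=> _; apply: inC CB _.
  case/andP => /and3P[/and4P[_ DP _ /existsP[a /existsP[c /and3P[aC cD ac]]]] _ DB] pp yl.
  apply: connect_trans (inC _ _ _ _ CP CB xC aC) _.
  apply: connect_trans (connect1 _) (IH D c DP cD DB pp yl).
  by rewrite /induced /= ac (inB' _ C) ?(inB' _ D).
Qed.

End ClusterMinor.

(** * Trees of depth two through chosen centres *)

Section HubTree.
Variables (R : realType) (V : finType) (e : rel V) (w : V -> V -> R).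
Hypothesis sym_e : forall x y, e x y = e y x.
Hypothesis sym_w : forall x y, w x y = w y x.
Hypothesis w_ge0 : forall x y, e x y -> 0 <= w x y.
Hypothesis conn_e : connected_graph e.
Variables (root : V) (s : V -> V).

(* [inr c] is a Steiner copy of the centre [c], so that [inl] embeds [V]. *)
Definition hub_par (u : V + V) : V + V := if u is inl x then inr (s x) else inr root.
Definition hub_pos (u : V + V) : V := match u with inl x | inr x => x end.
(** Edges weigh the graph distance between the positions [hub_pos] of their ends. The edge from a
    vertex to its own Steiner copy has weight [0], which [is_tree] allows. *)
Definition hub_tree : dtree R V :=
  @DTree R V (V + V)%type (par_rel hub_par)
    (fun a b => gdist e w (hub_pos a) (hub_pos b)) inl.

Definition hub_ht (u : V + V) : nat := if u is inr c then c != root else 2.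

Lemma hub_ht_par u : hub_par u != u -> (hub_ht (hub_par u) < hub_ht u)%N.
Proof.
case: u => [x|c] /= nc; first by rewrite ltnS leq_b1.
by rewrite eqxx lt0b; apply: contraNneq nc => ->.
Qed.

Let sym_t := par_rel_sym hub_par.
Let d_ge0 (a b : V + V) : 0 <= gdist e w (hub_pos a) (hub_pos b).
Proof. exact: gdist_ge0. Qed.

Let t_ge0 (a b : V + V) : par_rel hub_par a b -> 0 <= gdist e w (hub_pos a) (hub_pos b).
Proof. by move=> _; apply: d_ge0. Qed.

Let t_sym (a b : V + V) :
  gdist e w (hub_pos a) (hub_pos b) = gdist e w (hub_pos b) (hub_pos a).
Proof. exact: gdist_sym. Qed.

Lemma hub_connected : connected_graph (par_rel hub_par).
Proof.
have up u : connect (par_rel hub_par) u (hub_par u).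
  have [<-|nu] := eqVneq u (hub_par u); first exact: connect0.
  by apply: connect1; rewrite /par_rel /= nu eqxx.
have top u : connect (par_rel hub_par) u (inr root).
  case: u => [x|c]; last exact: (up (inr c)).
  exact: connect_trans (up (inl x)) (up (inr (s x))).
move=> u v; apply: connect_trans (top u) _.
by rewrite (sym_connect_sym (sym_t)).
Qed.

Lemma hub_tree_is_tree : is_tree (@tE _ _ hub_tree) (@tW _ _ hub_tree).
Proof.
split; last exact: (par_rel_acyclic hub_ht_par).
split.
- exact: sym_t.
- by move=> x; rewrite /= /par_rel /= eqxx.
- by move=> x y; apply: gdist_sym.
- by move=> x y _; apply: d_ge0.
- exact: hub_connected.
Qed.

(** By the triangle inequality, a tree path is at least as long as the distance between the
    positions of its ends. *)
Lemma hub_tree_dominating : dominating_tree e w hub_tree.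
Proof.
split; [exact: hub_tree_is_tree | by move=> x y [] | move=> x y].
apply: gdist_ge => [|p _ lp]; first exact: hub_connected.
have key (u : V + V) q :
    gdist e w (hub_pos u) (hub_pos (last u q)) <= plen (@tW _ _ hub_tree) u q.
  elim: q u => [|v q IH] u /=; first by rewrite gdistxx.
  apply: le_trans (gdist_triangle w_ge0 conn_e (hub_pos v) _ _) _.
  by apply: lerD => //; apply: IH.
by have := key (inl x) p; rewrite lp.
Qed.

Lemma hub_dist_par u :
  gdist (@tE _ _ hub_tree) (@tW _ _ hub_tree) u (hub_par u) <=
  gdist e w (hub_pos u) (hub_pos (hub_par u)).
Proof.
have [<-|nu] := eqVneq u (hub_par u).
  by rewrite [X in X <= _](gdistxx t_ge0 hub_connected); apply: d_ge0.
by apply: (gdist_edge t_ge0); rewrite /= /par_rel /= nu eqxx.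
Qed.

Lemma hub_dist_via u z v :
  gdist (@tE _ _ hub_tree) (@tW _ _ hub_tree) u v <=
  gdist (@tE _ _ hub_tree) (@tW _ _ hub_tree) u z +
  gdist (@tE _ _ hub_tree) (@tW _ _ hub_tree) v z.
Proof.
rewrite [X in _ <= _ + X](gdist_sym sym_t t_sym t_ge0 hub_connected).
exact: (gdist_triangle t_ge0 hub_connected).
Qed.

Lemma hub_tree_diam : gdiam (@tE _ _ hub_tree) (@tW _ _ hub_tree) <= 4 * gdiam e w.
Proof.
have D0 := gdiam_ge0 e w.
have top u : gdist (@tE _ _ hub_tree) (@tW _ _ hub_tree) u (inr root) <= 2 * gdiam e w.
  (* The root is its own parent, so two parent steps end there from every node. *)
  have -> : inr root = hub_par (hub_par u) by case: u.
  apply: le_trans (gdist_triangle t_ge0 hub_connected (hub_par u) _ _) _.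
  have h1 := hub_dist_par u; have h2 := hub_dist_par (hub_par u).
  have g1 := gdist_le_gdiam e w (hub_pos u) (hub_pos (hub_par u)).
  have g2 := gdist_le_gdiam e w (hub_pos (hub_par u)) (hub_pos (hub_par (hub_par u))).
  lra.
have D4 : 0 <= 4 * gdiam e w by rewrite mulr_ge0.
apply: bigmax_le => // u _; apply: bigmax_le => // v _.
apply: le_trans (hub_dist_via u (inr root) v) _.
have := top u; have := top v; lra.
Qed.

(** The route turns at the common centre [inr c] and need not climb to the root. *)
Lemma hub_tree_dist x y c : s x = c -> s y = c ->
  tdist hub_tree x y <= gdist e w x c + gdist e w c y.
Proof.
move=> sx sy; apply: le_trans (hub_dist_via _ (inr c) _) _.
have hx := hub_dist_par (inl x); have hy := hub_dist_par (inl y).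
rewrite /= sx in hx; rewrite /= sy in hy.
by rewrite [X in _ <= _ + X](gdist_sym sym_e sym_w w_ge0 conn_e); apply: lerD.
Qed.

End HubTree.

(** * Assembly of the tree cover *)

Lemma In_map (A B : Type) (f : A -> B) (s : seq A) y :
  List.In y (map f s) -> exists x, y = f x.
Proof. by elim: s => //= a s IH [<-|/IH //]; exists a. Qed.

Lemma map_In (A : eqType) (B : Type) (f : A -> B) (s : seq A) x :
  x \in s -> List.In (f x) (map f s).
Proof.
by elim: s => //= a s IH; rewrite inE => /orP[/eqP->|/IH]; [left | right].
Qed.

(** With [z] on [pi] in the hub cluster, the detour to the centre and back adds at most
    [2 * eps * gdiam e w] to the length of [pi], which exceeds the distance by at most
    [eps * gdiam e w]. The constant [4] leaves slack and agrees with the diameter bound. *)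
Lemma tree_cover_of_shortcut (R : realType) (r h : nat) (V : finType) (e : rel V)
    (w : V -> V -> R) (eps : R) (P : {set {set V}}) :
  wgraph e w -> connected_graph e -> ~ has_K_minor e r -> 0 < eps ->
  shortcut_partition e w eps h P ->
  exists Ts : seq (dtree R V),
    [/\ tree_cover e w Ts (4 * eps * gdiam e w),
        bounded_cover Ts (4 * gdiam e w) &
        (size Ts <= 2 ^ ((r + 2) * h.+1))%N].
Proof.
case=> sym_e _ sym_w w_gt0 conn nm e0 [partP connP diamP shortP].
have w_ge0 x y : e x y -> 0 <= w x y by move=> /w_gt0/ltW.
(* An empty vertex set offers no root; there the empty cover works. *)
have [root _|V0] := pickP (fun _ : V => true); last first.
  by exists [::]; split=> //; split=> // x; have := V0 x.
have [F [szF FP]] := hub_family h (cadj_sym P sym_e)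
   (fun m => nm (cadj_minor partP connP root m)).
(* [root] is a filler for the empty set; the hub cluster used below meets [pi], so its centre lies
   in it. *)
pose rep (C : {set V}) := odflt root [pick x in C].
pose T (phi : {ffun {set V} -> {set V}}) :=
  hub_tree e w root (fun x => rep (phi (pblock P x))).
exists (map T F); split; last by rewrite size_map.
- split=> [t ht|x y].
    by have [phi ->] := In_map ht; apply: hub_tree_dominating.
  have [pi [ppi lpi lenpi [q [pq lq sq allq]]]] := shortP x y.
  have [phi [C [phiF Cq phix phiy]]] := FP _ _ pq sq.
  exists (T phi); split; first exact: map_In.
  (* [cadj] leads only to members of [P], so every node of the cluster path is a cluster. *)
  have CP : C \in P.
    move: Cq; rewrite inE => /orP[/eqP->|]; first exact: pblock_in.
    elim: (q) (pblock P x) pq => //= D q' IH B /andP[/and4P[_ DP _ _] pq'].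
    by rewrite inE => /orP[/eqP->//|]; apply: IH pq'.
  have /hasP[z zpi zC] := allP allq _ Cq.
  have cC : rep C \in C by rewrite /rep; case: pickP => //= /(_ z); rewrite zC.
  have tri := gdist_triangle w_ge0 conn.
  have near a b : a \in C -> b \in C -> gdist e w a b <= eps * gdiam e w.
    move=> aC bC; apply: le_trans (diamP _ CP _ _ aC bC).
    exact: gdist_induced (connP _ CP _ _ aC bC).
  have le1 : gdist e w x z + gdist e w z y <= plen w x pi.
    case/splitPl: zpi lpi ppi => p1 p2 lp; rewrite last_cat cat_path plen_cat lp.
    move=> ly /andP[pp1 pp2]; apply: lerD; first by rewrite -lp gdist_le_plen.
    by rewrite -ly gdist_le_plen.
  apply: le_trans (hub_tree_dist sym_e sym_w w_ge0 conn root
     (s := fun x => rep (phi (pblock P x))) (x := x) (y := y) (c := rep C) _ _) _.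
  + by rewrite phix.
  + by rewrite -lq phiy.
  have n1 := near _ _ zC cC; have n2 := near _ _ cC zC.
  have t1 := tri z x (rep C); have t2 := tri z (rep C) y.
  have le2 : eps * gdist e w x y <= eps * gdiam e w.
    by rewrite ler_pM2l // gdist_le_gdiam.
  have D0 : 0 <= eps * gdiam e w by rewrite mulr_ge0 ?gdiam_ge0 // ltW.
  rewrite -mulrA; move: lenpi le2; rewrite mulrDl mul1r.
  lra.
- by move=> t ht; have [phi ->] := In_map ht; apply: hub_tree_diam.
Qed.

Theorem theorem1p7 (R : realType) (r : nat) :
  exists (c : R) (k : nat), 0 < c /\
  forall (V : finType) (e : rel V) (w : V -> V -> R) (f : R -> nat),
    wgraph e w -> connected_graph e -> ~ has_K_minor e r ->
    (forall eps : R, 0 < eps < 1 ->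
       exists P : {set {set V}}, shortcut_partition e w eps (f eps) P) ->
    forall eps : R, 0 < eps < 1 ->
      exists Ts : seq (dtree R V),
        [/\ tree_cover e w Ts (c * eps * gdiam e w),
            bounded_cover Ts (c * gdiam e w) &
            (size Ts <= 2 ^ (k * (f eps).+1))%N].
Proof.
(* [4] serves both distortion and diameter; [r + 2] comes from the size bound of [hub_family]. *)
exists 4, (r + 2)%N; split=> // V e w f wg conn nm sp eps he.
have [P hP] := sp eps he; have /andP[e0 _] := he.
exact: tree_cover_of_shortcut hP.
Qed.
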